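(* Let $n,s\in\mathbb{N}$ with $n\ge 2$, $1\le 2s-1\le 2n-1$ and $n\neq 2s-1$. Let $R=\{2,\,2s-1,\,4n-(2s-1)\}$ and $S=\{2,\,2n-(2s-1),\,2n+2s-1\}$. Then $$\theta_{8n,2,n}(C_{8n}(R))=C_{8n}(S)=\theta_{8n,2,3n}(C_{8n}(R)),\qquad \theta_{8n,2,n}(C_{8n}(S))=C_{8n}(R)=\theta_{8n,2,3n}(C_{8n}(S)),$$ $$\theta_{8n,2,2n}(C_{8n}(R))=C_{8n}(R),\qquad \theta_{8n,2,2n}(C_{8n}(S))=C_{8n}(S),$$ and the circulant graphs $C_{8n}(R)$ and $C_{8n}(S)$ are Type-2 isomorphic with respect to $m=2$. When instead $n=2s-1$, the two circulant graphs $C_{8n}(R)$ and $C_{8n}(S)$ are the same.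
   Context: Circulant graph: for $n\in\mathbb{N}$ and a set $R\subseteq\{1,\dots,\lfloor n/2\rfloor\}$ of jump sizes, $C_n(R)$ is the graph with vertex set $\mathbb{Z}_n$ (vertex $i$ also written $v_i$) in which $i$ is adjacent to $i\pm r$ (mod $n$) for each $r\in R$. Reflexive modulo $n$: for $y\in\mathbb{Z}$, $yR$ computed under reflexive modulo $n$ is the set obtained by reducing each $yr$ ($r\in R$) modulo $n$ and replacing any residue $r'>n/2$ by $n-r'$. Let $\varphi_n=\{y\in\mathbb{Z}_n:\gcd(n,y)=1\}$. The map $\theta_{n,m,t}$: for a divisor $m>1$ of $n$ and $0\le t\le \frac nm-1$, $\theta_{n,m,t}:\mathbb{Z}_n\to\mathbb{Z}_n$ is $\theta_{n,m,t}(x)=x+jtm \pmod n$, where $x=qm+j$, $0\le j\le m-1$, $0\le q\le \frac nm-1$. The graph $\theta_{n,m,t}(C_n(R))$ has vertex set $\mathbb{Z}_n$ and edges $\{\theta_{n,m,t}(x),\theta_{n,m,t}(x+s)\}$ for $x\in\mathbb{Z}_n$, $s\in R$. Equality of graphs means equality as labelled graphs on $\mathbb{Z}_n$. Type-2 isomorphism with respect to $m$: let $|R|\ge 3$, $r\in R$, $m>1$, $m\mid\gcd(n,r)$ and $m^3\mid n$. If for some $t$ with $0\le t\le\frac nm-1$ one has $\theta_{n,m,t}(C_n(R))=C_n(S)$ for some $S$, and $S\ne yR$ (under reflexive modulo $n$) for all $y\in\varphi_n$, then $C_n(R)$ and $C_n(S)$ are called Type-2 isomorphic with respect to $m$. 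*)

(* Defs.v *)
From mathcomp Require Import all_boot all_order all_algebra.
From mathcomp Require Import finmap.

Set Implicit Arguments.
Unset Strict Implicit.
Unset Printing Implicit Defensive.

Import GRing.Theory.
Local Open Scope ring_scope.

(* A graph with vertex set Z_n is given by its set of edges {u, v}, so that
   equality of labelled graphs on Z_n is equality in [lgraph n].  As 'Z_n is
   Z/nZ only for 1 < n, graphs are only meaningful under that condition. *)
Definition lgraph (n : nat) := {set {set 'Z_n}}.

Definition jump_set (n : nat) (R : {fset nat}) : Prop :=
  forall r : nat, r \in R -> (1 <= r <= n %/ 2)%N.

Definition circulant_adj (n : nat) (R : {fset nat}) : rel 'Z_n :=
  fun i j => [exists r : R, (j == i + (val r)%:R) || (j == i - (val r)%:R)].

Definition circulant (n : nat) (R : {fset nat}) : lgraph n :=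
  [set e | [exists i : 'Z_n, exists j : 'Z_n,
              circulant_adj R i j && (e == [set i; j])]].

(* In x = q m + j with 0 <= j < m, the remainder j is x %% m.  The map is
   meant for m > 1, m %| n and t < n %/ m. *)
Definition theta (n m t : nat) (x : 'Z_n) : 'Z_n :=
  x + ((x %% m) * t * m)%N%:R.

(* theta_{n,m,t}(C_n(R)) *)
Definition theta_circulant (n m t : nat) (R : {fset nat}) : lgraph n :=
  [set e | [exists x : 'Z_n, exists s : R,
              e == [set theta m t x; theta m t (x + (val s)%:R)]]].

Definition reflexive_mod (n : nat) (z : int) : nat :=
  let r' := `|(z %% n%:Z)%Z|%N in if (n < 2 * r')%N then (n - r')%N else r'.

(* y R, computed under reflexive modulo n *)
Definition reflexive_mul (n : nat) (y : int) (R : {fset nat}) : {fset nat} :=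
  [fset reflexive_mod n (y * r%:Z) | r in R]%fset.

(* The representatives y : 'I_n prime to n form the set phi_n. *)
Definition type2_isomorphic (n m : nat) (R S : {fset nat}) : Prop :=
  [/\ jump_set n R /\ jump_set n S,
      (3 <= #|` R|)%N,
      (1 < m)%N /\ (exists2 r : nat, r \in R & (m %| gcdn n r)%N),
      (m ^ 3 %| n)%N &
      (exists2 t : nat, (t <= n %/ m - 1)%N &
         theta_circulant n m t R = circulant n S) /\
      (forall y : 'I_n, coprime n y -> S <> reflexive_mul n (nat_of_ord y)%:Z R)].

(* Main.v *)
Require Import Defs.
From mathcomp Require Import all_boot all_order all_algebra.
From mathcomp Require Import finmap.
From mathcomp Require Import zify ring.

(** Write D(R) = {±r : r in R}.  The map theta_{N,2,t} fixes even vertices and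
    adds 2t to odd ones, so it sends C_N(R) to C_N(S) as soon as D(R) and D(S)
    have the same even elements and the odd elements of D(S) are those of D(R)
    translated by 2t.  Modulo 8n, translation by 2n exchanges {±k, ±(4n - k)}
    and {±(2n - k), ±(2n + k)}; iterating it gives the cases t = 2n and t = 3n.
    If yR = S with y odd, comparing even elements forces y = ±1 mod 4n, so the
    odd elements of yR are ±k mod 4n, whereas 2n - k is not unless k = n. *)

Set Implicit Arguments.
Unset Strict Implicit.
Unset Printing Implicit Defensive.

Import GRing.Theory Num.Theory.
Local Open Scope ring_scope.

(** * Edges of circulant graphs through signed jumps *)

Definition jump_diff (N : nat) (R : {fset nat}) (d : 'Z_N) : bool :=
  [exists r : R, (d == (val r)%:R) || (d == - (val r)%:R)].

Lemma jump_diffN N R (d : 'Z_N) : jump_diff R (- d) = jump_diff R d.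
Proof. by apply: eq_existsb => r; rewrite eqr_oppLR eqr_opp orbC. Qed.

Lemma circulant_adjE N R (i j : 'Z_N) : circulant_adj R i j = jump_diff R (j - i).
Proof. by apply: eq_existsb => r; rewrite !subr_eq addrC [- _ + i]addrC. Qed.

Lemma circulantP N R (e : {set 'Z_N}) :
  reflect (exists x d, jump_diff R d /\ e = [set x; x + d]) (e \in circulant N R).
Proof.
rewrite inE; apply: (iffP existsP) => [[x /existsP[y /andP[]]]|[x [d [Rd ->]]]].
  by rewrite circulant_adjE => Rd /eqP->; exists x, (y - x); rewrite subrKC.
by exists x; apply/existsP; exists (x + d); rewrite circulant_adjE addrC addKr Rd /=.
Qed.

Lemma theta_circulantP N m t R (e : {set 'Z_N}) :
  reflect (exists x d, jump_diff R d /\ e = [set theta m t x; theta m t (x + d)])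
          (e \in theta_circulant N m t R).
Proof.
rewrite inE; apply: (iffP existsP) => [[x /existsP[r /eqP->]]|[x [d [/existsP[r]]]]].
  by exists x, (val r)%:R; split=> //; apply/existsP; exists r; rewrite eqxx.
case/orP=> /eqP-> ->; first by exists x; apply/existsP; exists r.
(* A negative difference [- r] is realised by basing the same unordered edge at [x - r]. *)
exists (x - (val r)%:R); apply/existsP; exists r.
by rewrite subrK setUC.
Qed.

(** The second hypothesis gives one inclusion. The right inverse [g] gives the other, by pulling the
    endpoints of an edge of [circulant N S] back through [theta m t]. *)
Lemma theta_circulant_eq N m t R S (g : 'Z_N -> 'Z_N) :
  cancel g (@theta N m t) ->
  (forall x y : 'Z_N, jump_diff S (theta m t y - theta m t x) = jump_diff R (y - x)) ->
  theta_circulant N m t R = circulant N S.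
Proof.
move=> gK RS; apply/setP=> e; apply/theta_circulantP/circulantP.
  move=> [x [d [Rd ->]]]; exists (theta m t x), (theta m t (x + d) - theta m t x).
  by rewrite RS subrKC [x + d]addrC addrK.
move=> [x [d [Sd ->]]]; exists (g x), (g (x + d) - g x).
by rewrite -RS subrKC !gK [x + d]addrC addrK.
Qed.

(** * Parity in Z_N for even N, and the maps with m = 2 *)

Section EvenModulus.

Variable N : nat.
Hypotheses (N_gt1 : (1 < N)%N) (N_even : ~~ odd N).

Lemma odd_modn_even m : odd (m %% N) = odd m.
Proof. by rewrite [in RHS](divn_eq m N) oddD oddM (negbTE N_even) andbF. Qed.

Lemma odd_Zp_nat m : odd (m%:R : 'Z_N) = odd m.
Proof. by rewrite val_Zp_nat // odd_modn_even. Qed.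

Lemma odd_ZpD (x y : 'Z_N) : odd (x + y)%R = odd x (+) odd y.
Proof.
rewrite -oddD -[RHS]odd_modn_even; congr (odd _).
by rewrite /=; congr (_ %% _)%N; exact: Zp_cast.
Qed.

Lemma odd_ZpN (x : 'Z_N) : odd (- x) = odd x.
Proof.
have := odd_ZpD (- x) x; rewrite addNr /=.
by case: (odd x); case: (odd (- x)).
Qed.

Lemma theta2E t (x : 'Z_N) :
  theta 2 t x = if odd x then x + (2 * t)%:R else x.
Proof.
by rewrite /theta modn2; case: (odd x); rewrite ?mul1n ?mul0n ?addr0 // mulnC.
Qed.

Lemma odd_theta2 t (x : 'Z_N) : odd (theta 2 t x) = odd x.
Proof.
rewrite theta2E; case: ifP => // x_odd.
by rewrite odd_ZpD odd_Zp_nat oddM addbF.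
Qed.

(** Endpoints of equal parity are moved by the same amount, so their even difference is kept;
    endpoints of opposite parity have their odd difference moved by [2 * t], up to sign. *)
Lemma theta2_circulant_eq t R S :
  (forall d : 'Z_N,
     jump_diff S d = jump_diff R (if odd d then d - (2 * t)%:R else d)) ->
  theta_circulant N 2 t R = circulant N S.
Proof.
move=> RS.
apply: (@theta_circulant_eq _ _ _ _ _
  (fun x => if odd x then x - (2 * t)%:R else x)) => [x|x y].
  rewrite theta2E; case x_odd: (odd x); last by rewrite x_odd.
  by rewrite odd_ZpD odd_ZpN x_odd odd_Zp_nat oddM /= subrK.
case x_odd: (odd x); case y_odd: (odd y).
- rewrite RS odd_ZpD odd_ZpN !odd_theta2 x_odd y_odd /= !theta2E x_odd y_odd.
  by rewrite opprD addrACA subrr addr0.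
(* For [x] odd and [y] even the shift is by [- 2 * t]; since D(R) and D(S) are closed under
   negation, exchanging the endpoints turns it into a shift by [2 * t]. *)
- rewrite -[LHS]jump_diffN -[RHS]jump_diffN !opprB RS.
  rewrite odd_ZpD odd_ZpN !odd_theta2 x_odd y_odd /= !theta2E x_odd y_odd.
  by rewrite addrAC addrK.
- rewrite RS odd_ZpD odd_ZpN !odd_theta2 x_odd y_odd /= !theta2E x_odd y_odd.
  by rewrite addrAC addrK.
- by rewrite RS odd_ZpD odd_ZpN !odd_theta2 x_odd y_odd /= !theta2E x_odd y_odd.
Qed.

Lemma jump_diff_2odd p q (d : 'Z_N) : odd p -> odd q ->
  jump_diff [fset 2%N; p; q]%fset d =
  if odd d then d \in [:: p%:R; - p%:R; q%:R; - q%:R] else d \in [:: 2; - 2].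
Proof.
move=> p_odd q_odd; rewrite !inE.
have -> : jump_diff [fset 2%N; p; q]%fset d =
    [|| (d == 2) || (d == - 2), (d == p%:R) || (d == - p%:R)
      | (d == q%:R) || (d == - q%:R)].
  apply/existsP/idP => [[[r /= +]]|].
    by rewrite !inE -orbA => /or3P[] /eqP-> ->; rewrite ?orbT.
  have rP r : r \in [fset 2%N; p; q]%fset -> (d == r%:R) || (d == - r%:R) ->
    exists r : [fset 2%N; p; q]%fset, (d == (val r)%:R) || (d == - (val r)%:R).
    by move=> rR dr; exists [` rR]%fset.
  by case/or3P=> dr; apply: rP dr; rewrite !inE eqxx ?orbT.
(* Parity separates the jump 2 from the jumps [p] and [q]. *)
have oddE r : odd d != odd r -> (d == r%:R) || (d == - r%:R) = false.
  by apply: contraNF => /orP[] /eqP->; rewrite ?odd_ZpN odd_Zp_nat.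
case d_odd: (odd d); first by rewrite (oddE 2) ?d_odd // -?orbA.
by rewrite (oddE p) ?(oddE q) ?d_odd ?p_odd ?q_odd ?orbF.
Qed.

Lemma theta2_circulant_2odd t p q p' q' :
  odd p -> odd q -> odd p' -> odd q' ->
  (forall d : 'Z_N, (d \in [:: p'%:R; - p'%:R; q'%:R; - q'%:R])
     = (d - (2 * t)%:R \in [:: p%:R; - p%:R; q%:R; - q%:R])) ->
  theta_circulant N 2 t [fset 2%N; p; q]%fset = circulant N [fset 2%N; p'; q']%fset.
Proof.
move=> p_odd q_odd p'_odd q'_odd pq; apply: theta2_circulant_eq => d.
rewrite !jump_diff_2odd //; case d_odd: (odd d); last by rewrite d_odd.
by rewrite odd_ZpD odd_ZpN d_odd odd_Zp_nat oddM /= pq.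
Qed.

End EvenModulus.

(** * Translation by 2c when 8c = 0 *)

Section Translation.

Variables (A : comNzRingType) (c k : A).
Hypothesis c8_eq0 : 8 * c = 0.

Let P := [:: k; - k; 4 * c - k; - (4 * c - k)].
Let Q := [:: 2 * c - k; - (2 * c - k); 2 * c + k; - (2 * c + k)].

Lemma mem_shift_PQ d : (d \in Q) = (d - 2 * c \in P).
Proof.
rewrite !inE !subr_eq.
(* The sides differ by [8 * c], which is inserted as a zero so that [ring] applies. *)
have -> : - (2 * c + k) = 4 * c - k + 2 * c by rewrite -[LHS]addr0 -c8_eq0; ring.
have -> : - (2 * c - k) = - (4 * c - k) + 2 * c by ring.
by rewrite [k + _]addrC [- k + _]addrC; do ![case: (_ == _)].
Qed.

(** By [mem_shift_PQ] this amounts to invariance of [P] under translation by [4 * c], which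
    exchanges [k] with [- (4 * c - k)] and [- k] with [4 * c - k]. *)
Lemma mem_shift_QP d : (d \in P) = (d - 2 * c \in Q).
Proof.
rewrite mem_shift_PQ !inE !subr_eq.
have -> : k + 2 * c + 2 * c = - (4 * c - k) by rewrite -[RHS]addr0 -c8_eq0; ring.
have -> : - k + 2 * c + 2 * c = 4 * c - k by ring.
have -> : 4 * c - k + 2 * c + 2 * c = - k by rewrite -[RHS]addr0 -c8_eq0; ring.
have -> : - (4 * c - k) + 2 * c + 2 * c = k by ring.
by do ![case: (_ == _)].
Qed.

End Translation.

(** * No odd multiplier y sends R to S *)

Lemma reflexive_mod_spec (N : nat) (z : int) : (0 < N)%N ->
  exists q : int, z = q * N%:Z + (reflexive_mod N z)%:Z
               \/ z = q * N%:Z - (reflexive_mod N z)%:Z.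
Proof.
move=> N_gt0; rewrite /reflexive_mod.
have r_ge0 : 0 <= (z %% N%:Z)%Z by rewrite modz_ge0 //; lia.
have r_lt : (z %% N%:Z)%Z < N%:Z by rewrite ltz_pmod.
have zE := divz_eq z N%:Z.
case: ifP => _; last by exists (z %/ N%:Z)%Z; left; lia.
by exists ((z %/ N%:Z)%Z + 1); right; lia.
Qed.

Lemma reflexive_mul_neq n k (y : nat) : odd k -> (k < 2 * n)%N -> n <> k -> odd y ->
  [fset 2%N; (2 * n - k)%N; (2 * n + k)%N]%fset
    <> reflexive_mul (8 * n) y%:Z [fset 2%N; k; (4 * n - k)%N]%fset.
Proof.
move=> k_odd k_lt nk y_odd RS.
have preimS v : v \in [fset 2%N; (2 * n - k)%N; (2 * n + k)%N]%fset ->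
    exists2 r, r \in [fset 2%N; k; (4 * n - k)%N]%fset
      & exists q : int, y%:Z * r%:Z = q * (8 * n)%N%:Z + v%:Z
                     \/ y%:Z * r%:Z = q * (8 * n)%N%:Z - v%:Z.
  rewrite RS => /imfsetP[r /= rR ->]; exists r => //.
  by apply: reflexive_mod_spec; lia.
have odd_mul_y r : odd r -> exists a : int, y%:Z * r%:Z = 2 * a + 1.
  move=> r_odd; exists (y * r)./2%:Z.
  by have := odd_double_half (y * r); rewrite oddM y_odd r_odd; lia.
have [|r2 r2R [q2 yr2]] := preimS 2%N; first by rewrite !inE eqxx.
have [|r rR [q yr]] := preimS (2 * n - k)%N; first by rewrite !inE eqxx orbT.
move: r2R rR; rewrite !inE -!orbA => r2R rR.
have [u uE] : exists u : int, y%:Z = 4 * n%:Z * u + 1 \/ y%:Z = 4 * n%:Z * u - 1.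
  (* If [r2] were odd, [y * r2] would be odd, yet it is ±2 modulo [8 * n]. So [r2] is 2, and halving
     [2 * y = 8 * n * q2 ± 2] gives the witness [q2]. *)
  exists q2; case/or3P: r2R => /eqP r2E; first by move: yr2; rewrite r2E; lia.
    by have [|a] := odd_mul_y r2; lia.
  by have [|a] := odd_mul_y r2; lia.
have small (w v : int) : 4 * n%:Z * w = v -> `|v| < 4 * n%:Z -> v = 0.
  have n4_gt0 : 0 < 4 * n%:Z by lia.
  move=> <-; rewrite normrM (gtr0_norm n4_gt0) gtr_pMr // => w_lt1.
  by have -> : w = 0; [lia | rewrite mulr0].
case/or3P: rR => /eqP rE; first by move: yr; rewrite rE; lia.
(* Here [4 * n * (u * k - 2 * q)] is, up to sign, [2 * n] or [2 * n - 2 * k]. Both are below [4 * n]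
   in absolute value, so one of them vanishes, against [0 < n] or [n <> k]. *)
- have := small (u * k%:Z - 2 * q) (4 * n%:Z * (u * k%:Z - 2 * q)) erefl.
  move: yr; rewrite rE; case: uE => -> ; lia.
- have rE' : r%:Z = 4 * n%:Z - k%:Z by lia.
  move: yr; rewrite rE'; case: uE => ->.
    (* The term ±1 absorbs the [4 * n] of [r = 4 * n - k], which leaves the same values as for
       [r = k]. *)
    by have := small (u * r%:Z - 2 * q + 1) _ erefl; rewrite rE'; lia.
  by have := small (u * r%:Z - 2 * q - 1) _ erefl; rewrite rE'; lia.
Qed.

(** * The pair R, S modulo 8n, with k for 2s - 1 *)

Section Type2Pair.

Variables n k : nat.
Hypotheses (n_gt0 : (0 < n)%N) (k_odd : odd k) (k_lt : (k < 2 * n)%N).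

Let R : {fset nat} := [fset 2%N; k; (4 * n - k)%N]%fset.
Let S : {fset nat} := [fset 2%N; (2 * n - k)%N; (2 * n + k)%N]%fset.
Let c : 'Z_(8 * n) := n%:R.
Let kc : 'Z_(8 * n) := k%:R.

Lemma n8_gt1 : (1 < 8 * n)%N. Proof. lia. Qed.
Lemma n8_even : ~~ odd (8 * n). Proof. by rewrite oddM. Qed.

Lemma n8_eq0 : 8 * c = 0.
Proof. by rewrite -natrM -[RHS](pchar_Zp n8_gt1). Qed.

Lemma cast_4nBk : (4 * n - k)%N%:R = 4 * c - kc.
Proof. by rewrite natrB ?natrM //; lia. Qed.

Lemma cast_2nBk : (2 * n - k)%N%:R = 2 * c - kc.
Proof. by rewrite natrB ?natrM //; lia. Qed.

Lemma cast_2nDk : (2 * n + k)%N%:R = 2 * c + kc.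
Proof. by rewrite natrD natrM. Qed.

(** For t = 2n the odd differences move by 4n, written as two moves by [2 * c] so that the shift
    lemmas chain. *)
Lemma sub_cast_4n d : d - (2 * (2 * n))%N%:R = d - 2 * c - 2 * c.
Proof. by rewrite !natrM -/c; ring. Qed.

Lemma sub_cast_6n d : d - (2 * (3 * n))%N%:R = d - 2 * c - 2 * c - 2 * c.
Proof. by rewrite !natrM -/c; ring. Qed.

Let cast_jumps := (cast_4nBk, cast_2nBk, cast_2nDk).

Lemma odd_jumps :
  [/\ odd k, odd (4 * n - k), odd (2 * n - k) & odd (2 * n + k)].
Proof. by split=> //; lia. Qed.

Lemma theta_n_RS : theta_circulant (8 * n) 2 n R = circulant (8 * n) S.
Proof.
have [? ? ? ?] := odd_jumps.
apply: (theta2_circulant_2odd n8_gt1 n8_even) => // d.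
by rewrite !cast_jumps natrM (mem_shift_PQ _ n8_eq0).
Qed.

Lemma theta_n_SR : theta_circulant (8 * n) 2 n S = circulant (8 * n) R.
Proof.
have [? ? ? ?] := odd_jumps.
apply: (theta2_circulant_2odd n8_gt1 n8_even) => // d.
by rewrite !cast_jumps natrM (mem_shift_QP _ n8_eq0).
Qed.

Lemma theta_2n_R : theta_circulant (8 * n) 2 (2 * n) R = circulant (8 * n) R.
Proof.
have [? ? ? ?] := odd_jumps.
apply: (theta2_circulant_2odd n8_gt1 n8_even) => // d.
rewrite !cast_jumps (mem_shift_QP _ n8_eq0) (mem_shift_PQ _ n8_eq0).
by rewrite sub_cast_4n.
Qed.

Lemma theta_2n_S : theta_circulant (8 * n) 2 (2 * n) S = circulant (8 * n) S.
Proof.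
have [? ? ? ?] := odd_jumps.
apply: (theta2_circulant_2odd n8_gt1 n8_even) => // d.
rewrite !cast_jumps (mem_shift_PQ _ n8_eq0) (mem_shift_QP _ n8_eq0).
by rewrite sub_cast_4n.
Qed.

Lemma theta_3n_RS : theta_circulant (8 * n) 2 (3 * n) R = circulant (8 * n) S.
Proof.
have [? ? ? ?] := odd_jumps.
apply: (theta2_circulant_2odd n8_gt1 n8_even) => // d.
(* Three moves by [2 * c] alternate between the two lists, so the net effect is the exchange. *)
rewrite !cast_jumps (mem_shift_PQ _ n8_eq0) (mem_shift_QP _ n8_eq0).
rewrite (mem_shift_PQ _ n8_eq0).
by rewrite sub_cast_6n.
Qed.

Lemma theta_3n_SR : theta_circulant (8 * n) 2 (3 * n) S = circulant (8 * n) R.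
Proof.
have [? ? ? ?] := odd_jumps.
apply: (theta2_circulant_2odd n8_gt1 n8_even) => // d.
rewrite !cast_jumps (mem_shift_QP _ n8_eq0) (mem_shift_PQ _ n8_eq0).
rewrite (mem_shift_QP _ n8_eq0).
by rewrite sub_cast_6n.
Qed.

Lemma type2_isomorphic_RS : n <> k -> type2_isomorphic (8 * n) 2 R S.
Proof.
move=> nk; split.
- by split=> r; rewrite !inE -orbA => /or3P[] /eqP->; lia.
(* Parity separates 2 from the two odd jumps, and [k < 2 * n] gives [k < 4 * n - k]. *)
- by rewrite /R fsetUC cardfsU1 cardfs2 !inE; lia.
- split=> //; exists 2%N; first by rewrite !inE eqxx.
  by rewrite dvdn_gcd dvdnn andbT; apply/dvdnP; exists (4 * n)%N; lia.
- by rewrite dvdn_mulr.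
split; first by exists n; [lia | exact: theta_n_RS].
move=> y y_coprime; apply: reflexive_mul_neq => //.
by rewrite -coprime2n; apply: coprime_dvdl y_coprime; apply: dvdn_mulr.
Qed.

End Type2Pair.

Local Close Scope ring_scope.

Theorem theorem4p2 (n s : nat) (hn : 2 <= n) (hs1 : 1 <= 2 * s - 1)
    (hs2 : 2 * s - 1 <= 2 * n - 1) :
  let R : {fset nat} := [fset 2; (2 * s - 1)%N; (4 * n - (2 * s - 1))%N]%fset in
  let S : {fset nat} := [fset 2; (2 * n - (2 * s - 1))%N; (2 * n + (2 * s - 1))%N]%fset in
  (n <> 2 * s - 1 ->
     (theta_circulant (8 * n) 2 n R = circulant (8 * n) S /\
      circulant (8 * n) S = theta_circulant (8 * n) 2 (3 * n) R) /\
     (theta_circulant (8 * n) 2 n S = circulant (8 * n) R /\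
      circulant (8 * n) R = theta_circulant (8 * n) 2 (3 * n) S) /\
     theta_circulant (8 * n) 2 (2 * n) R = circulant (8 * n) R /\
     theta_circulant (8 * n) 2 (2 * n) S = circulant (8 * n) S /\
     type2_isomorphic (8 * n) 2 R S) /\
  (n = 2 * s - 1 -> circulant (8 * n) R = circulant (8 * n) S).
Proof.
have n_gt0 : 0 < n by lia.
have k_odd : odd (2 * s - 1) by lia.
have k_lt : 2 * s - 1 < 2 * n by lia.
move=> R S; split=> [nk|nk].
  rewrite theta_n_RS // theta_n_SR // theta_2n_R // theta_2n_S //.
  rewrite theta_3n_RS // theta_3n_SR //.
  by do 4!split=> //; apply: type2_isomorphic_RS.
(* With [n] equal to [2 * s - 1], both sets read {2, n, 3n}, entry by entry. *)
by congr circulant; rewrite /R /S -nk; congr [fset _; _; _]%fset; lia.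
Qed.
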